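(* Let $n\ge 2$ be an integer and let $H$ be a finitely generated subgroup of $\operatorname{BS}(1,n)$. Then $e\text{-}\mathrm{Cl}(H)=\operatorname{BS}(1,n)$, or $e\text{-}\mathrm{Cl}(H)\cong\mathbb{Z}\left[\tfrac1n\right]$, or $e\text{-}\mathrm{Cl}(H)\cong\mathbb{Z}$ (isomorphisms of groups).
   Context: $\operatorname{BS}(1,n)=\langle a,t\mid tat^{-1}=a^n\rangle$. $\mathbb{Z}\left[\tfrac1n\right]$ denotes the additive group $\{l/n^k\mid l\in\mathbb{Z},k\ge 0\}\subset\mathbb{Q}$. For an endomorphism $\varphi$ of a group $G$, $\operatorname{Fix}\varphi=\{g\in G\mid\varphi(g)=g\}$. $\operatorname{End}(G)$ is the monoid of endomorphisms of $G$. For a subgroup $H\le G$, the endo-fixed closure of $H$ in $G$ is the subgroup $e\text{-}\mathrm{Cl}(H)=\bigcap_{\varphi\in\operatorname{End}(G),\,H\le\operatorname{Fix}\varphi}\operatorname{Fix}\varphi$.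
   Formalization: The subgroup H is additionally assumed nontrivial: for H = 1 the claim fails, since the trivial endomorphism fixes H and has trivial fixed subgroup, so e-Cl(1) = 1, which is none of BS(1,n), Z[1/n], Z. *)

(* Defs.v *)
From HB Require Import structures.
From mathcomp Require Import all_boot all_order all_algebra.
From mathcomp Require Import boolp classical_sets functions.

Set Implicit Arguments.
Unset Strict Implicit.
Unset Printing Implicit Defensive.

Local Open Scope classical_set_scope.
Local Open Scope quotient_scope.
Local Open Scope group_scope.

(* The letter (x, false) stands for the generator x, (x, true) for its        *)
(* inverse.                                                                   *)
Definition word (X : choiceType) : choiceType := seq (X * bool)%type.

Definition word_inv (X : choiceType) (w : word X) : word X :=
  rev [seq (l.1, ~~ l.2) | l <- w].

(* Equality of words in the group < X | u = v, R u v >.                       *)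
Inductive pres_eq (X : choiceType) (R : word X -> word X -> Prop) :
    word X -> word X -> Prop :=
| PresRefl u : pres_eq R u u
| PresSym u v : pres_eq R u v -> pres_eq R v u
| PresTrans u v w : pres_eq R u v -> pres_eq R v w -> pres_eq R u w
| PresCat u u' v v' :
    pres_eq R u u' -> pres_eq R v v' -> pres_eq R (u ++ v) (u' ++ v')
| PresCancel x b : pres_eq R [:: (x, b); (x, ~~ b)] [::]
| PresRel u v : R u v -> pres_eq R u v.

Section PresentedGroup.
Variables (X : choiceType) (R : word X -> word X -> Prop).

Definition pres_rel : rel (word X) := fun u v => `[< pres_eq R u v >].

Lemma pres_rel_equiv : equiv_class_of pres_rel.
Proof.
split=> [u|u v|v u w].
- exact/asboolP/PresRefl.
- by apply/asboolP/asboolP => /PresSym.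
- by move=> /asboolP uv /asboolP vw; apply/asboolP/(PresTrans uv vw).
Qed.

Canonical pres_equiv := EquivRelPack pres_rel_equiv.

Definition presented := {eq_quot pres_equiv}.

HB.instance Definition _ := Choice.on presented.
HB.instance Definition _ := EqQuotient.on presented.

Definition pres_pi (u : word X) : presented := \pi_presented u.

Lemma pres_piP (u v : word X) : pres_eq R u v <-> pres_pi u = pres_pi v.
Proof. by split=> [uv|/eqquotP/asboolP//]; apply/eqquotP/asboolP. Qed.

Lemma word_mulwV (u : word X) : pres_eq R (u ++ word_inv u) [::].
Proof.
elim: u => [|[x b] u IHu]; first exact: (PresRefl R [::]).
have -> : ((x, b) :: u) ++ word_inv ((x, b) :: u) =
    [:: (x, b)] ++ ((u ++ word_inv u) ++ [:: (x, ~~ b)]).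
  by rewrite /word_inv map_cons rev_cons -cats1 /= -catA.
apply: (PresTrans _ (PresCancel R x b)).
apply: (PresCat (u' := [:: _]) (v' := [:: _]) (PresRefl _ _)).
exact: (PresCat (u' := [::]) IHu (PresRefl _ _)).
Qed.

Lemma word_invK : involutive (@word_inv X).
Proof.
move=> u; rewrite /word_inv map_rev revK -map_comp -[RHS]map_id.
by apply: eq_map => -[x b] /=; rewrite negbK.
Qed.

Lemma word_mulVw (u : word X) : pres_eq R (word_inv u ++ u) [::].
Proof. by have := word_mulwV (word_inv u); rewrite word_invK. Qed.

Definition pres_one : presented := pres_pi [::].
Definition pres_mul (g h : presented) : presented := pres_pi (repr g ++ repr h).
Definition pres_inv (g : presented) : presented := pres_pi (word_inv (repr g)).

Lemma pres_reprK (g : presented) : pres_pi (repr g) = g.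
Proof. exact: reprK. Qed.

Lemma pres_mul_pi (u v : word X) :
  pres_mul (pres_pi u) (pres_pi v) = pres_pi (u ++ v).
Proof. by apply/pres_piP/PresCat; apply/pres_piP; rewrite pres_reprK. Qed.

Lemma pres_mulA : associative pres_mul.
Proof.
move=> g h k; rewrite -(pres_reprK g) -(pres_reprK h) -(pres_reprK k).
move: (repr g) (repr h) (repr k) => u v w.
by rewrite (pres_mul_pi v) !(pres_mul_pi u) pres_mul_pi catA.
Qed.

Lemma pres_mul1g : left_id pres_one pres_mul.
Proof. by move=> g; rewrite -(pres_reprK g) pres_mul_pi. Qed.

Lemma pres_mulg1 : right_id pres_one pres_mul.
Proof. by move=> g; rewrite -(pres_reprK g) pres_mul_pi cats0. Qed.

Lemma pres_mulVg : left_inverse pres_one pres_inv pres_mul.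
Proof.
move=> g; rewrite -[X in pres_mul _ X]pres_reprK pres_mul_pi.
exact/pres_piP/word_mulVw.
Qed.

Lemma pres_mulgV : right_inverse pres_one pres_inv pres_mul.
Proof.
move=> g; rewrite -[X in pres_mul X _]pres_reprK pres_mul_pi.
exact/pres_piP/word_mulwV.
Qed.

HB.instance Definition _ := isGroup.Build presented
  pres_mulA pres_mul1g pres_mulg1 pres_mulVg pres_mulgV.

End PresentedGroup.

Inductive bs_gen := bs_a | bs_t.
HB.instance Definition _ := gen_eqMixin bs_gen.
HB.instance Definition _ := gen_choiceMixin bs_gen.

(* The single relation t a t^-1 = a^n.                                        *)
Inductive bs_relation (n : nat) : word bs_gen -> word bs_gen -> Prop :=
  BSRelation : bs_relation n
    [:: (bs_t, false); (bs_a, false); (bs_t, true)] (nseq n (bs_a, false)).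

Definition BS (n : nat) : groupType := presented (bs_relation n).

Section GroupNotions.
Variable G : groupType.

Definition is_subgroup (H : set G) : Prop := group_closed [in H].

Definition fg_subgroup (H : set G) : Prop :=
  exists s : seq G, H = smallest is_subgroup [set` s].

Definition Fix (phi : {multiplicative G -> G}) : set G :=
  [set g | phi g = g].

Definition e_closure (H : set G) : set G :=
  \bigcap_(phi in [set phi : {multiplicative G -> G} | H `<=` Fix phi]) Fix phi.

End GroupNotions.

(* Isomorphism between a subgroup A of G and a subgroup B of K.               *)
Definition subgroup_iso (G K : groupType) (A : set G) (B : set K) : Prop :=
  exists f : G -> K, set_bij A B f /\ {in A &, {morph f : x y / x * y}}.

Definition Z_inv (n : nat) : set rat :=
  [set q | exists (l : int) (k : nat), q = (l%:Q / n%:R ^+ k)%R].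

(* Main.v *)
Require Import Defs.
From HB Require Import structures.
From mathcomp Require Import all_boot all_order all_algebra.
From mathcomp Require Import boolp classical_sets functions.
From mathcomp Require Import ring.

(* BS(1,n) embeds in the affine group Q x| Z, where a = (1, 0), t = (0, 1) and Z
   acts through powers of n. An endomorphism fixing a nontrivial element has the
   form (x, k) |-> (alpha x + beta (n^k - 1)/(n - 1), k), so that its fixed points
   are the solutions of a linear equation c x + b (n^k - 1) = 0; conversely every
   such equation with c, b in Z[1/n] occurs. The closure of H is therefore
   governed by the span of the vectors (x, n^k - 1), (x, k) in H: if the span is
   the axis n^k = 1, the closure is the subgroup Z[1/n]; if it is another line,
   the second coordinate k embeds the closure in Z; and if it is the plane, only
   the identity fixes H. *)

Set Implicit Arguments.
Unset Strict Implicit.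
Unset Printing Implicit Defensive.

Import Order.TTheory GRing.Theory Num.Theory.
Local Open Scope ring_scope.

(* MathComp's [gmulf1], [gmulfV] and [gmulfXn] require a [UMagmaMorphism]
   structure, which [{multiplicative _ -> _}] does not carry. *)
Section GroupMorphism.
Variables (G K : groupType) (f : {multiplicative G -> K}).

Lemma multiplicative1 : f 1%g = 1%g.
Proof. by apply: (mulgI (f 1%g)); rewrite -gmulfM !mulg1. Qed.

Lemma multiplicativeV g : f g^-1%g = (f g)^-1%g.
Proof. by apply/esym/mulg1_eq; rewrite -gmulfM mulgV multiplicative1. Qed.

Lemma multiplicativeX g m : f (g ^+ m)%g = (f g ^+ m)%g.
Proof.
elim: m => [|m IHm]; first exact: multiplicative1.
by rewrite !expgS gmulfM IHm.
Qed.

End GroupMorphism.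

(** * Presented groups: induction on words and the universal property *)

Section PresentedGroupTheory.
Variables (X : choiceType) (R : word X -> word X -> Prop).
Implicit Types (x : X) (u v : word X) (P : presented R -> Prop).

Definition pres_gen x : presented R := pres_pi R [:: (x, false)].

Lemma pres_pi_cat u v : pres_pi R (u ++ v) = (pres_pi R u * pres_pi R v)%g.
Proof. by rewrite -pres_mul_pi. Qed.

Lemma pres_pi_invgen x : pres_pi R [:: (x, true)] = (pres_gen x)^-1%g.
Proof.
apply/esym/mulg1_eq; rewrite -pres_pi_cat.
exact/pres_piP/(PresCancel R x false).
Qed.

Lemma pres_pi_nseq m x : pres_pi R (nseq m (x, false)) = (pres_gen x ^+ m)%g.
Proof. by elim: m => [//|m IHm]; rewrite expgS -IHm -pres_pi_cat. Qed.

Lemma pres_ind_left P :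
    P 1%g -> (forall x g, P g -> P (pres_gen x * g)%g) ->
    (forall x g, P g -> P ((pres_gen x)^-1 * g)%g) -> forall g, P g.
Proof.
move=> P1 Pgen Pinv g; rewrite -(pres_reprK g).
elim: (repr g) => [//|[x b] w IHw].
rewrite -cat1s pres_pi_cat; case: b; first by rewrite pres_pi_invgen; apply: Pinv.
exact: Pgen.
Qed.

Lemma pres_ind P :
    (forall x, P (pres_gen x)) -> (forall g h, P g -> P h -> P (g * h)%g) ->
    (forall g, P g -> P (g^-1)%g) -> P 1%g -> forall g, P g.
Proof.
move=> Pgen PM PV P1; apply: pres_ind_left => // x g Pg; apply: PM => //.
exact: PV.
Qed.

(** Von Dyck's theorem: evaluation of words respects every constructor of [pres_eq], so it descends
    to the quotient. *)
Lemma pres_lift (K : groupType) (f : X -> K) :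
    let ev (w : word X) :=
      (\prod_(l <- w) (if l.2 then (f l.1)^-1 else f l.1))%g in
    (forall u v, R u v -> ev u = ev v) ->
  exists phi : {multiplicative presented R -> K},
    forall x, phi (pres_gen x) = f x.
Proof.
move=> ev evR.
have ev_cat u v : ev (u ++ v) = (ev u * ev v)%g by rewrite /ev big_cat.
have ev_eq u v : pres_eq R u v -> ev u = ev v.
  elim=> //; first by move=> u1 v1 w _ -> _ ->.
    by move=> u1 u2 v1 v2 _ Eu _ Ev; rewrite !ev_cat Eu Ev.
  move=> x b; rewrite /ev !big_cons !big_nil /= mulg1.
  by case: b; rewrite ?mulVg ?mulgV.
pose F (g : presented R) := ev (repr g).
have F_pi u : F (pres_pi R u) = ev u.
  by apply/ev_eq/pres_piP; rewrite pres_reprK.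
have FM : {morph F : g h / (g * h)%g}.
  move=> g h; rewrite -(pres_reprK g) -(pres_reprK h).
  by rewrite -pres_pi_cat !F_pi ev_cat.
pose phi : {multiplicative presented R -> K} :=
  HB.pack F (isMultiplicative.Build _ _ F FM).
by exists phi => x; rewrite /= F_pi /ev big_seq1.
Qed.

End PresentedGroupTheory.

(** * Commutation rules and a normal form in BS(1,n) *)

Section BaumslagSolitar.
Variable n : nat.
Local Notation a := (pres_gen (bs_relation n) bs_a : BS n).
Local Notation t := (pres_gen (bs_relation n) bs_t : BS n).

Lemma bs_conj : (t * a * t^-1 = a ^+ n)%g.
Proof.
rewrite -pres_pi_nseq -pres_pi_invgen -[(t * a)%g]pres_pi_cat -pres_pi_cat.
exact/pres_piP/PresRel/BSRelation.
Qed.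

Lemma bs_lift (K : groupType) (a' t' : K) :
    (t' * a' * t'^-1 = a' ^+ n)%g ->
  exists phi : {multiplicative BS n -> K}, phi a = a' /\ phi t = t'.
Proof.
move=> rel'; pose f s := if s is bs_a then a' else t'.
have [|phi phiE] := @pres_lift _ (bs_relation n) K f.
  move=> _ _ [] /=; rewrite !big_cons big_nil /= mulg1 mulgA rel'.
  elim: n => [|m IHm]; first by rewrite big_nil.
  by rewrite big_cons /= -IHm expgS.
by exists phi; rewrite !phiE.
Qed.

Lemma bs_tXa p j : (t ^+ j * a ^+ p = a ^+ (p * n ^ j) * t ^+ j)%g.
Proof.
have ta m : (t * a ^+ m = a ^+ (m * n) * t)%g.
  have /(congr1 (fun g => g * t)%g) := bs_conj; rewrite mulgVK => ta1.
  elim: m => [|m IHm]; first by rewrite mulg1 mul1g.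
  by rewrite expgS mulgA ta1 -mulgA IHm mulgA -expgnDr -mulSn.
elim: j p => [|j IHj] p; first by rewrite muln1 mulg1 mul1g.
by rewrite expgSr -mulgA ta mulgA IHj -mulgA -expgSr -mulnA -expnS.
Qed.

(** Products of this shape are stable under left multiplication by each letter: [a] crosses [t^-j]
    as [a^(n^j)], and [t] cancels one [t^-1]. The exponent of [a] is split as [p - r] to keep all
    four exponents natural. *)
Lemma bs_normal_form (g : BS n) :
  exists j p r i, (g = t ^- j * (a ^+ p * a ^- r) * t ^+ i)%g.
Proof.
have at_ p j : (a ^+ p * t ^- j = t ^- j * a ^+ (p * n ^ j))%g.
  by apply: (mulgI (t ^+ j)%g); rewrite mulgA bs_tXa mulgK mulVKg.
have aVt p j : (a ^- p * t ^- j = t ^- j * a ^- (p * n ^ j))%g.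
  by apply: invg_inj; rewrite !invgM !invgK bs_tXa.
have ta p : (t * a ^+ p = a ^+ (p * n) * t)%g by rewrite (bs_tXa p 1).
have taV p : (t * a ^- p = a ^- (p * n) * t)%g.
  by apply: (mulgI (a ^+ (p * n))%g); rewrite mulgA -ta mulgK mulVKg.
elim/pres_ind_left: g => [|[]|[]] {}.
- by exists 0%N, 0%N, 0%N, 0%N; rewrite !gsimp.
- move=> _ [j] [p] [r] [i] ->.
  exists j, (n ^ j + p)%N, r, i.
  by rewrite !mulgA (at_ 1%N) mul1n -(mulgA _ _ (a ^+ p)%g) -expgnDr.
(* When [j = 0] there is no [t^-1] to cancel; [t] then moves right across the powers of [a],
   multiplying their exponents by [n]. *)
- move=> _ [[|j]] [p] [r] [i] ->.
    exists 0%N, (p * n)%N, (r * n)%N, i.+1.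
    by rewrite invg1 !mul1g !mulgA ta -(mulgA _ t) taV expgS !mulgA.
  by exists j, p, r, i; rewrite expgSr invgM !mulgA mulgV mul1g.
- move=> _ [j] [p] [r] [i] ->.
  exists j, p, (n ^ j + r)%N, i.
  rewrite !mulgA (aVt 1%N) mul1n expgnDr invgM -!mulgA; congr (_ * _)%g.
  rewrite !mulgA; congr (_ * _)%g.
  have aC m : commute (a ^- (n ^ j))%g (a ^+ m)%g.
    exact/commute_sym/commuteV/commuteX2.
  by rewrite -mulgA; apply: commuteM => //; apply: commuteV.
- move=> _ [j] [p] [r] [i] ->.
  by exists j.+1, p, r, i; rewrite expgSr invgM !mulgA.
Qed.

End BaumslagSolitar.

(* The parameter is shifted, here and in every [BS n.+1] below, so that the
   multiplier [n.+1] is nonzero. *)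
Definition affine (n : nat) : Type := (rat * int)%type.

(** * The affine group and the representation of BS(1,n+1) in it *)

Section Affine.
Variable n : nat.
Let q : rat := n.+1%:R.

HB.instance Definition _ := Choice.copy (affine n) (rat * int)%type.

Let q_unit : q \is a GRing.unit.
Proof. by rewrite unitfE pnatr_eq0. Qed.

Definition affine_one : affine n := (0, 0).
(** Composition of maps, where [(x, k)] stands for [z |-> x + q ^ k * z]. *)
Definition affine_mul (g h : affine n) : affine n :=
  (g.1 + q ^ g.2 * h.1, g.2 + h.2).
Definition affine_inv (g : affine n) : affine n := (- (q ^ (- g.2) * g.1), - g.2).

Lemma affine_mulA : associative affine_mul.
Proof.
by move=> g h k; rewrite /affine_mul /= expfzDr // mulrDr addrA mulrA addrA.
Qed.

Lemma affine_mul1g : left_id affine_one affine_mul.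
Proof. by move=> [x k]; rewrite /affine_mul /= expr0z mul1r !add0r. Qed.

Lemma affine_mulg1 : right_id affine_one affine_mul.
Proof. by move=> [x k]; rewrite /affine_mul /= mulr0 !addr0. Qed.

Lemma affine_mulVg : left_inverse affine_one affine_inv affine_mul.
Proof. by move=> [x k]; rewrite /affine_mul /= !addNr. Qed.

Lemma affine_mulgV : right_inverse affine_one affine_inv affine_mul.
Proof.
move=> [x k]; rewrite /affine_mul /= subrr mulrN mulrA -expfzDr //.
by rewrite subrr expr0z mul1r subrr.
Qed.

HB.instance Definition _ := isGroup.Build (affine n)
  affine_mulA affine_mul1g affine_mulg1 affine_mulVg affine_mulgV.

Lemma affine_expg (x : rat) m : (((x, 0) : affine n) ^+ m)%g = (x *+ m, 0).
Proof.
elim: m => [//|m IHm]; rewrite expgS IHm mulrS.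
by congr (_, _); rewrite /= expr0z mul1r.
Qed.

Lemma bs_affine_exists : exists rho : {multiplicative BS n.+1 -> affine n},
  rho (pres_gen (bs_relation n.+1) bs_a) = (1, 0) /\
  rho (pres_gen (bs_relation n.+1) bs_t) = (0, 1).
Proof.
apply: bs_lift; rewrite affine_expg.
apply: (mulIg ((0, 1) : affine n)); rewrite mulgVK; congr (_, _) => /=.
by rewrite !mulr0 mulr1 add0r addr0.
Qed.

End Affine.

Definition bs_affine n : {multiplicative BS n.+1 -> affine n} :=
  sval (cid (bs_affine_exists n)).
Definition bs_pos n (g : BS n.+1) : rat := (bs_affine n g).1.
Definition bs_exp n (g : BS n.+1) : int := (bs_affine n g).2.

(** * Closure properties of Z[1/(n+1)] *)

Section ZInv.
Variable n : nat.
Local Notation q := (n.+1%:R : rat).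

Let qX_neq0 k : q ^+ k != 0.
Proof. by rewrite expf_neq0 // pnatr_eq0. Qed.

Lemma Z_inv_int (l : int) : Z_inv n.+1 l%:~R.
Proof. by exists l, 0%N; rewrite expr0 divr1. Qed.

Lemma Z_invB (x y : rat) : Z_inv n.+1 x -> Z_inv n.+1 y -> Z_inv n.+1 (x - y).
Proof.
move=> [l [k ->]] [l' [k' ->]].
exists (l * n.+1%:Z ^+ k' - l' * n.+1%:Z ^+ k), (k + k')%N.
rewrite intrB !intrM !rmorphXn /= -!pmulrn exprD.
by field; rewrite !qX_neq0.
Qed.

Lemma Z_invM (x y : rat) : Z_inv n.+1 x -> Z_inv n.+1 y -> Z_inv n.+1 (x * y).
Proof.
move=> [l [k ->]] [l' [k' ->]]; exists (l * l'), (k + k')%N.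
by rewrite intrM exprD; field; rewrite !qX_neq0.
Qed.

Lemma Z_inv_exprz (k : int) : Z_inv n.+1 (q ^ k).
Proof.
case: k => k; last by exists 1, k.+1; rewrite mul1r.
by exists (n.+1%:Z ^+ k), 0%N; rewrite expr0 divr1 rmorphXn.
Qed.

End ZInv.

(** * Affine coordinates: injectivity and image of the representation *)

Section Coordinates.
Variable n : nat.
Local Notation q := (n.+1%:R : rat).
Local Notation a := (pres_gen (bs_relation n.+1) bs_a : BS n.+1).
Local Notation t := (pres_gen (bs_relation n.+1) bs_t : BS n.+1).
Local Notation pos := (@bs_pos n).
Local Notation exp := (@bs_exp n).
Implicit Types (g h : BS n.+1).

Let q_unit : q \is a GRing.unit.
Proof. by rewrite unitfE pnatr_eq0. Qed.

Lemma bs_pos_a : pos a = 1.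
Proof. by rewrite /bs_pos /bs_affine; case: cid => rho [/= -> _]. Qed.
Lemma bs_exp_a : exp a = 0.
Proof. by rewrite /bs_exp /bs_affine; case: cid => rho [/= -> _]. Qed.
Lemma bs_pos_t : pos t = 0.
Proof. by rewrite /bs_pos /bs_affine; case: cid => rho [/= _ ->]. Qed.
Lemma bs_exp_t : exp t = 1.
Proof. by rewrite /bs_exp /bs_affine; case: cid => rho [/= _ ->]. Qed.

Lemma bs_pos1 : pos 1%g = 0. Proof. by rewrite /bs_pos multiplicative1. Qed.
Lemma bs_exp1 : exp 1%g = 0. Proof. by rewrite /bs_exp multiplicative1. Qed.

Lemma bs_posM g h : pos (g * h)%g = pos g + q ^ exp g * pos h.
Proof. by rewrite /bs_pos gmulfM. Qed.

Lemma bs_expM g h : exp (g * h)%g = exp g + exp h.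
Proof. by rewrite /bs_exp gmulfM. Qed.

Lemma bs_posV g : pos g^-1%g = - (q ^ (- exp g) * pos g).
Proof. by rewrite /bs_pos multiplicativeV. Qed.

Lemma bs_expV g : exp g^-1%g = - exp g.
Proof. by rewrite /bs_exp multiplicativeV. Qed.

Lemma bs_expX g m : exp (g ^+ m)%g = exp g *+ m.
Proof.
by elim: m => [|m IHm]; rewrite ?bs_exp1 // expgS bs_expM IHm mulrS.
Qed.

Lemma bs_posX g m : exp g = 0 -> pos (g ^+ m)%g = pos g *+ m.
Proof.
move=> eg; elim: m => [|m IHm]; rewrite ?bs_pos1 // expgS bs_posM IHm.
by rewrite eg expr0z mul1r -mulrS.
Qed.

Lemma bs_pos_tX m : pos (t ^+ m)%g = 0.
Proof.
elim: m => [|m IHm]; rewrite ?bs_pos1 // expgS bs_posM IHm bs_pos_t.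
by rewrite mulr0 addr0.
Qed.

Lemma bs_pos_normal j p r i :
  pos (t ^- j * (a ^+ p * a ^- r) * t ^+ i)%g = (p%:Z - r%:Z)%:~R / q ^+ j.
Proof.
rewrite !bs_posM bs_pos_tX mulr0 addr0 !bs_posV bs_pos_tX mulr0 oppr0 add0r.
rewrite !bs_posX ?bs_exp_a // !bs_expV !bs_expX bs_exp_a bs_exp_t bs_pos_a.
rewrite !mul0rn oppr0 expr0z !mul1r intrB -!pmulrn mulrC; congr (_ * _).
by rewrite natz exprnN.
Qed.

Lemma bs_exp_normal j p r i :
  exp (t ^- j * (a ^+ p * a ^- r) * t ^+ i)%g = i%:Z - j%:Z.
Proof.
rewrite !bs_expM !bs_expV !bs_expX bs_exp_a bs_exp_t !mul0rn !natz.
by rewrite oppr0 !addr0 addrC.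
Qed.

(** Faithfulness of the representation: on a normal form the two conditions read [p = r] and
    [i = j], and the word collapses. *)
Lemma bs_coord_eq1 g : pos g = 0 -> exp g = 0 -> g = 1%g.
Proof.
have [j [p [r [i ->]]]] := bs_normal_form g.
rewrite bs_pos_normal bs_exp_normal => /eqP.
rewrite mulf_eq0 invr_eq0 expf_eq0 pnatr_eq0 andbF orbF intr_eq0 subr_eq0.
by move=> /eqP[->] /eqP; rewrite subr_eq0 => /eqP[->]; rewrite mulgV mulg1 mulVg.
Qed.

Lemma bs_coord_inj g h : pos g = pos h -> exp g = exp h -> g = h.
Proof.
move=> pgh egh; apply: divg1_eq; apply: bs_coord_eq1.
  by rewrite bs_posM bs_posV egh mulrN mulrA -expfzDr // subrr expr0z mul1r pgh subrr.
by rewrite bs_expM bs_expV egh subrr.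
Qed.

Lemma bs_pos_Z_inv g : Z_inv n.+1 (pos g).
Proof.
have [j [p [r [i ->]]]] := bs_normal_form g; rewrite bs_pos_normal.
by exists (p%:Z - r%:Z), j.
Qed.

(** The element [t^-m a^l t^m] has position [l / q ^ m] and exponent 0; a power of [t] on the right
    then sets the exponent without changing the position. *)
Lemma bs_coord_surj (x : rat) (k : int) :
  Z_inv n.+1 x -> exists g, pos g = x /\ exp g = k.
Proof.
move=> [l [m ->]].
have [p [r ->]] : exists p r : nat, l = p%:Z - r%:Z.
  case: l => l; first by exists l, 0%N; rewrite subr0.
  by exists 0%N, l.+1; rewrite sub0r NegzE.
have [s [ps es]] : exists s, pos s = 0 /\ exp s = k.
  case: k => k; first by exists (t ^+ k)%g; rewrite bs_pos_tX bs_expX bs_exp_t natz.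
  exists (t ^- k.+1)%g; rewrite bs_posV bs_pos_tX mulr0 oppr0.
  by rewrite bs_expV bs_expX bs_exp_t natz NegzE.
exists (t ^- m * (a ^+ p * a ^- r) * t ^+ m * s)%g.
by rewrite bs_posM ps mulr0 addr0 bs_pos_normal bs_expM bs_exp_normal subrr add0r.
Qed.

End Coordinates.

(** * Endomorphisms in coordinates and their fixed points *)

Section Endomorphisms.
Variable n : nat.
Hypothesis n_gt0 : (0 < n)%N.
Local Notation q := (n.+1%:R : rat).
Local Notation a := (pres_gen (bs_relation n.+1) bs_a : BS n.+1).
Local Notation t := (pres_gen (bs_relation n.+1) bs_t : BS n.+1).
Local Notation pos := (@bs_pos n).
Local Notation exp := (@bs_exp n).
Implicit Types (g h : BS n.+1) (phi : {multiplicative BS n.+1 -> BS n.+1}).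

(** Conjugating [g] by the translation by [b] subtracts [b * bs_dil g] from its position.
    Accordingly [bs_dil] obeys the same twisted product law as [bs_pos]. *)
Definition bs_dil g : rat := q ^ exp g - 1.

Let q_unit : q \is a GRing.unit.
Proof. by rewrite unitfE pnatr_eq0. Qed.

Let q_gt1 : 1 < q. Proof. by rewrite ltr1n. Qed.

Let q_inj : injective (exprz q).
Proof. by apply: ieexprIz; [rewrite ltr0n | rewrite gt_eqF]. Qed.

Lemma bs_dil_eq0 g : (bs_dil g == 0) = (exp g == 0).
Proof. by rewrite subr_eq0 -[1](expr0z q) (inj_eq q_inj). Qed.

Lemma bs_dilM g h : bs_dil (g * h)%g = bs_dil g + q ^ exp g * bs_dil h.
Proof. by rewrite /bs_dil bs_expM expfzDr //; move: (q ^ _) (q ^ _) => x y; ring. Qed.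

Lemma bs_dilV g : bs_dil g^-1%g = - (q ^ (- exp g) * bs_dil g).
Proof.
by rewrite /bs_dil bs_expV mulrBr -expfzDr // addNr expr0z mulr1 opprB.
Qed.

Lemma bs_dil_t : bs_dil t = q - 1.
Proof. by rewrite /bs_dil bs_exp_t. Qed.

(** Taking exponents in the image of the relation gives [e = n.+1 * e] for [e = exp (phi a)], and
    [n] is positive. *)
Lemma bs_endo_exp_a phi : exp (phi a) = 0.
Proof.
have /(congr1 (fun g => exp (phi g))) := bs_conj n.+1.
rewrite !gmulfM multiplicativeV multiplicativeX !bs_expM bs_expV bs_expX.
rewrite addrAC subrr add0r => /eqP; rewrite mulrS -subr_eq0 opprD addNKr.
by rewrite oppr_eq0 mulrn_eq0 eqn0Ngt n_gt0 /= => /eqP.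
Qed.

Lemma bs_endo_exp phi g : exp (phi g) = exp (phi t) * exp g.
Proof.
elim/pres_ind: g => [[]|g h eg eh|g eg|].
- by rewrite bs_endo_exp_a bs_exp_a mulr0.
- by rewrite bs_exp_t mulr1.
- by rewrite gmulfM !bs_expM eg eh mulrDr.
- by rewrite multiplicativeV !bs_expV eg mulrN.
- by rewrite multiplicative1 bs_exp1 mulr0.
Qed.

(** Comparing positions in the image of [t * a = a ^+ n.+1 * t] leaves [q ^ exp (phi t) * pos (phi
    a) = q * pos (phi a)]; here [pos (phi a)] is nonzero and the powers of [q] are distinct. *)
Lemma bs_endo_exp_t phi : phi a != 1%g -> exp (phi t) = 1.
Proof.
have /(congr1 (fun g => pos (phi (g * t)%g))) := bs_conj n.+1.
rewrite mulgVK !gmulfM multiplicativeX !bs_posM bs_expX (bs_posX _ (bs_endo_exp_a phi)).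
rewrite !bs_endo_exp_a mul0rn expr0z mul1r addrC => /addIr/eqP.
rewrite -[X in _ == X]mulr_natl -subr_eq0 -mulrBl mulf_eq0.
move=> /orP[/[!subr_eq0]/eqP qm _|/eqP pa0].
  by apply: q_inj; rewrite qm expr1z.
by case/eqP; apply: bs_coord_eq1 => //; apply: bs_endo_exp_a.
Qed.

Lemma bs_endo_ker phi g : phi a = 1%g -> exp g = 0 -> phi g = 1%g.
Proof.
have [j [p [r [i ->]]]] := bs_normal_form g => pa /eqP.
rewrite bs_exp_normal subr_eq0 => /eqP[->].
rewrite !gmulfM !multiplicativeV !multiplicativeX pa !expg1n.
by rewrite !gsimp.
Qed.

(** As [phi] preserves exponents, both sides obey the same twisted product law, so agreement on [a]
    and [t] suffices. Division by [q - 1], which is [bs_dil t], normalises the value at [t]. *)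
Lemma bs_endo_pos phi g : exp (phi t) = 1 ->
  pos (phi g) = pos (phi a) * pos g + pos (phi t) / (q - 1) * bs_dil g.
Proof.
move=> pt; have ephi h : exp (phi h) = exp h by rewrite bs_endo_exp pt mul1r.
have q1 : q - 1 != 0 by rewrite subr_eq0 gt_eqF.
elim/pres_ind: g => [[]|g h eg eh|g eg|].
- by rewrite bs_pos_a mulr1 /bs_dil bs_exp_a expr0z subrr mulr0 addr0.
- by rewrite bs_pos_t mulr0 add0r bs_dil_t divfK.
- by rewrite gmulfM !bs_posM bs_dilM eg eh ephi; move: (q ^ _) => x; ring.
- by rewrite multiplicativeV !bs_posV bs_dilV eg ephi; move: (q ^ _) => x; ring.
- by rewrite multiplicative1 bs_pos1 /bs_dil bs_exp1 expr0z subrr !mulr0 addr0.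
Qed.

Lemma bs_endo_fixP phi g : exp (phi t) = 1 -> phi g = g <->
  (pos (phi a) - 1) * pos g + pos (phi t) / (q - 1) * bs_dil g = 0.
Proof.
move=> pt; have := bs_endo_pos g pt; rewrite mulrBl mul1r addrAC => <-.
split=> [->|/eqP]; first by rewrite subrr.
rewrite subr_eq0 => /eqP pg; apply: bs_coord_inj => //.
by rewrite bs_endo_exp pt mul1r.
Qed.

Lemma bs_endo_fix_line phi h : h <> 1%g -> phi h = h ->
  exists c b : rat, forall g, phi g = g <-> c * pos g + b * bs_dil g = 0.
Proof.
move=> h1 fh; have pt : exp (phi t) = 1.
  have [pa|/bs_endo_exp_t//] := eqVneq (phi a) 1%g.
  (* If [phi] kills [a], it kills every element of exponent 0, so the fixed [h] has nonzero
     exponent, and [exp h = exp (phi t) * exp h] can be cancelled. *)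
  have [eh|eh] := eqVneq (exp h) 0; first by case: h1; rewrite -fh bs_endo_ker.
  by have /eqP := bs_endo_exp phi h; rewrite fh -{1}[exp h]mul1r => /eqP/(mulIf eh).
by exists (pos (phi a) - 1), (pos (phi t) / (q - 1)) => g; apply: bs_endo_fixP.
Qed.

(** The coefficients in [bs_endo_fixP] are prescribed by sending [a] to [(c + 1, 0)] and [t] to
    [(b * (q - 1), 1)], which satisfy the defining relation. *)
Lemma bs_line_endo_fix (c b : rat) : Z_inv n.+1 c -> Z_inv n.+1 b ->
  exists phi, forall g, phi g = g <-> c * pos g + b * bs_dil g = 0.
Proof.
move=> Zc Zb.
have Z1 : Z_inv n.+1 (1 : rat) by apply: (Z_inv_int n 1).
have [|a' [pa ea]] := @bs_coord_surj n (c + 1) 0.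
  by rewrite -[1]opprK; apply: Z_invB => //; apply: (Z_inv_int n (-1)).
have [|t' [pt et]] := @bs_coord_surj n (b * (q - 1)) 1.
  by apply: Z_invM => //; apply: Z_invB => //; apply: (Z_inv_int n n.+1).
have [|phi [phia phit]] := @bs_lift n.+1 _ a' t'.
  apply: bs_coord_inj; last first.
    by rewrite !bs_expM bs_expV bs_expX ea et mul0rn addr0 subrr.
  rewrite !bs_posM bs_posV bs_expM bs_posX // ea et pa pt addr0 expr1z.
  rewrite -[in RHS]mulr_natl exprN1.
  by rewrite mulrN mulVKf ?pnatr_eq0 // addrAC subrr add0r.
exists phi => g; rewrite bs_endo_fixP ?phit // phia pa pt addrK mulfK //.
by rewrite subr_eq0 gt_eqF.
Qed.

End Endomorphisms.

(** The generator is the least positive element of [D]; remainders modulo it lie in [D] and are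
    smaller, hence vanish. *)
Lemma int_subgroup_cyclic (D : int -> Prop) :
    (forall k l, D k -> D l -> D (k - l)) -> (exists2 k, D k & k != 0) ->
  exists2 d : int, d != 0 & forall k, D k <-> exists m : int, k = m * d.
Proof.
move=> DB [k0 Dk0 k0_neq0].
have D0 : D 0 by rewrite -(subrr k0); apply: DB.
have DN k : D k -> D (- k) by move=> Dk; rewrite -sub0r; apply: DB.
have DM (m k : int) : D k -> D (m * k).
  move=> Dk; have DnM i : D (i%:Z * k).
    elim: i => [|i IHi]; first by rewrite mul0r.
    have -> : i.+1%:Z * k = i%:Z * k - - k by rewrite opprK -addn1 PoszD mulrDl mul1r.
    by apply: DB => //; apply: DN.
  by case: m => m; first exact: DnM; rewrite NegzE mulNr; apply/DN/DnM.
have exD : exists d : nat, (0 < d)%N && `[< D d%:Z >].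
  exists `|k0|%N; rewrite absz_gt0 k0_neq0; apply/asboolP.
  have [k0_ge0|k0_lt0] := lerP 0 k0; first by rewrite gez0_abs.
  by rewrite ltz0_abs //; apply: DN.
have [d /andP[d_gt0 /asboolP Dd] d_min] := ex_minnP exD.
have d_neq0 : d%:Z != 0 by rewrite eqz_nat -lt0n.
exists d%:Z => //.
move=> k; split=> [Dk|[m ->]]; last exact: DM.
exists (k %/ d)%Z; rewrite {1}(divz_eq k d).
suff -> : (k %% d)%Z = 0 by rewrite addr0.
have : D (k %% d)%Z by rewrite /modz; apply: DB => //; apply: DM.
have : (k %% d < d)%Z by apply: ltz_pmod.
case: (k %% d)%Z (modz_ge0 k d_neq0) => // r _ ltrd Dr.
case: r ltrd Dr => // r ltrd /asboolP Dr.
by move: (d_min r.+1); rewrite Dr ltn0Sn => /(_ isT); rewrite leqNgt -ltz_nat ltrd.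
Qed.

(** * The candidate closures and the three cases *)

Section Closure.
Variable n : nat.
Hypothesis n_gt0 : (0 < n)%N.
Local Notation q := (n.+1%:R : rat).
Local Notation pos := (@bs_pos n).
Local Notation exp := (@bs_exp n).
Implicit Types (g h : BS n.+1) (H : set (BS n.+1)).

(** Elements of exponent 0 act as translations, so [bs_pos] is additive on them. *)
Lemma bs_exp0_iso :
  subgroup_iso (K := Algebra.to_multiplicative rat)
    [set g | exp g = 0]%classic (Z_inv n.+1).
Proof.
exists pos; split; first split.
- by move=> g _; apply: bs_pos_Z_inv.
- move=> g h /set_mem eg /set_mem eh pgh; apply: bs_coord_inj => //.
  by rewrite eg eh.
- by move=> x /(bs_coord_surj 0) [g [pg eg]]; exists g.
- by move=> g h /set_mem eg _; rewrite bs_posM eg expr0z mul1r.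
Qed.

(* The first set is the stabiliser of the point [- pos h / bs_dil h] under the
   affine action [g . z = pos g + q ^ exp g * z] on [rat]. *)
Lemma bs_stabiliser_iso h :
    exp h != 0 ->
  subgroup_iso [set g | pos g * bs_dil h = pos h * bs_dil g]%classic
    [set: Algebra.to_multiplicative int]%classic.
Proof.
set C := [set g | _]%classic => eh0.
have c0 : bs_dil h != 0 by rewrite bs_dil_eq0.
have CM g k : C g -> C k -> C (g / k)%g.
  move=> Cg Ck; rewrite /C /= bs_posM bs_posV bs_dilM bs_dilV mulrDl.
  rewrite [RHS]mulrDr Cg; congr (_ + _).
  by rewrite !(mulrN, mulNr) -!mulrA Ck !(mulrCA (pos h)).
(* On [C] the exponent determines the position, so [exp] embeds [C] in the integers; dividing by a
   generator [d] of the image makes this map onto. *)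
have C_inj g k : C g -> C k -> exp g = exp k -> g = k.
  move=> Cg Ck egk; apply: bs_coord_inj => //; apply: (mulIf c0).
  by rewrite Cg Ck /bs_dil egk.
have [||d d0 dP] := @int_subgroup_cyclic (fun k => exists2 g, C g & exp g = k).
- move=> _ _ [g Cg <-] [k Ck <-]; exists (g / k)%g; first exact: CM.
  by rewrite bs_expM bs_expV.
- by exists (exp h) => //; exists h.
have expC g : C g -> exists m, exp g = m * d by move=> Cg; apply/dP; exists g.
exists (fun g => (exp g %/ d)%Z); split; first split=> //.
- move=> g k /set_mem Cg /set_mem Ck; have [m em] := expC g Cg.
  have [m' em'] := expC k Ck; rewrite em em' !mulzK // => mm'.
  by apply: C_inj => //; rewrite em em' mm'.
- move=> m _; have [g Cg eg] : exists2 g, C g & exp g = m * d by apply/dP; exists m.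
  by exists g => //; rewrite eg mulzK.
- move=> g k /set_mem Cg /set_mem Ck; have [m em] := expC g Cg.
  by have [m' em'] := expC k Ck; rewrite bs_expM em em' -mulrDl !mulzK.
Qed.

Lemma bs_closure_exp0 H h :
    H h -> h <> 1%g -> (forall g, H g -> exp g = 0) ->
  e_closure H = [set g | exp g = 0]%classic.
Proof.
move=> Hh h1 H0; have dil0 g : exp g = 0 -> bs_dil g = 0.
  by move=> eg; apply/eqP; rewrite bs_dil_eq0 // eg.
apply/seteqP; split=> g /=.
  (* With [c = 0] and [b = 1] the fixed points are exactly the elements of exponent 0. *)
  have [phi phiP] := bs_line_endo_fix n_gt0 (Z_inv_int n 0) (Z_inv_int n 1).
  have fixP k : phi k = k <-> exp k = 0.
    by rewrite phiP mul0r mul1r add0r; split=> [/eqP|/dil0//]; rewrite bs_dil_eq0 // => /eqP.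
  by move=> /(_ phi) clg; apply/fixP/clg => k Hk; apply/fixP/H0.
move=> eg phi fixH; have [c [b phiP]] := bs_endo_fix_line n_gt0 h1 (fixH h Hh).
(* The equation at [h] reduces to [c * pos h = 0] with [pos h] nonzero, so [c = 0]. *)
have /phiP := fixH h Hh; rewrite dil0 ?H0 // mulr0 addr0 => /eqP.
rewrite mulf_eq0 => /orP[/eqP c0|/eqP ph0].
  by apply/phiP; rewrite c0 dil0 // mul0r mulr0 addr0.
by case: h1; apply: bs_coord_eq1 => //; apply: H0.
Qed.

Lemma bs_closure_stabiliser H h :
    H h -> exp h != 0 ->
    (forall g, H g -> pos g * bs_dil h = pos h * bs_dil g) ->
  e_closure H = [set g | pos g * bs_dil h = pos h * bs_dil g]%classic.
Proof.
move=> Hh eh HC; have c0 : bs_dil h != 0 by rewrite bs_dil_eq0.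
have h1 : h <> 1%g by move=> h1; rewrite h1 bs_exp1 in eh.
apply/seteqP; split=> g /=.
  have Zc : Z_inv n.+1 (bs_dil h).
    by apply: Z_invB; [apply: Z_inv_exprz | apply: (Z_inv_int n 1)].
  have Zp : Z_inv n.+1 (- pos h).
    rewrite -sub0r; apply: Z_invB; first exact: (Z_inv_int n 0).
    exact: bs_pos_Z_inv.
  (* The coefficients [bs_dil h] and [- pos h] give the line through the vector of [h]. *)
  have [phi phiP] := bs_line_endo_fix n_gt0 Zc Zp.
  have fixP k : phi k = k <-> pos k * bs_dil h = pos h * bs_dil k.
    rewrite phiP mulNr (mulrC (bs_dil h)).
    by split=> [/eqP|->]; rewrite ?subrr // subr_eq0 => /eqP.
  by move=> /(_ phi) clg; apply/fixP/clg => k Hk; apply/fixP/HC.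
move=> Cg phi fixH; have [c [b phiP]] := bs_endo_fix_line n_gt0 h1 (fixH h Hh).
(* Multiplied by [bs_dil h], the equation at [g] becomes [bs_dil g] times the equation at [h]. *)
have /phiP fh := fixH h Hh; apply/phiP/(mulIf c0).
rewrite mul0r -(mul0r (bs_dil g)) -fh mulrDl -mulrA Cg.
by move: (pos h) (bs_dil h) (bs_dil g) => *; ring.
Qed.

(** The equations at [g] and [h] form a linear system in [c] and [b] with nonzero determinant, so
    both vanish and [phi] is the identity. *)
Lemma bs_closure_full H h g :
    H h -> H g -> exp h != 0 -> pos g * bs_dil h != pos h * bs_dil g ->
  e_closure H = [set: BS n.+1]%classic.
Proof.
move=> Hh Hg eh; rewrite -subr_eq0 => Cg.
have c0 : bs_dil h != 0 by rewrite bs_dil_eq0.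
have h1 : h <> 1%g by move=> h1; rewrite h1 bs_exp1 in eh.
apply/seteqP; split=> // k _ phi fixH.
have [c [b phiP]] := bs_endo_fix_line n_gt0 h1 (fixH h Hh).
have /phiP fh := fixH h Hh; have /phiP fg := fixH g Hg.
have c_eq0 : c = 0.
  apply: (mulIf Cg); rewrite mul0r.
  transitivity ((c * pos g + b * bs_dil g) * bs_dil h
    - (c * pos h + b * bs_dil h) * bs_dil g); last by rewrite fh fg !mul0r subr0.
  by move: (pos g) (pos h) (bs_dil g) (bs_dil h) => *; ring.
have b_eq0 : b = 0.
  by apply: (mulIf c0); rewrite mul0r -fh c_eq0 mul0r add0r.
by apply/phiP; rewrite c_eq0 b_eq0 !mul0r addr0.
Qed.

End Closure.

Lemma fg_subgroup1 (G : groupType) (H : set G) : fg_subgroup H -> H 1%g.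
Proof. by move=> [s ->] K [[/set_mem K1 _] _]. Qed.

(** The trivial subgroup is excluded: the trivial endomorphism fixes it, so its closure is trivial
    and is none of the three groups. *)
Theorem theorem4p10 (n : nat) (H : set (BS n)) :
  (2 <= n)%N ->
  fg_subgroup H ->
  H <> [set 1%g]%classic ->
  [\/ e_closure H = [set: BS n]%classic,
      subgroup_iso (K := Algebra.to_multiplicative rat) (e_closure H) (Z_inv n)
    | subgroup_iso (e_closure H) [set: Algebra.to_multiplicative int]%classic].
Proof.
(* After the shift of the parameter, [2 <= n.+1] is [0 < n] by computation. *)
case: n H => // n H n_gt0 /fg_subgroup1 H1 Hneq1.
have [h Hh h1] : exists2 h, H h & h <> 1%g.
  apply: contrapT => /forall2NP noH; apply: Hneq1; apply/seteqP; split=> g.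
    by have [//|/contrapT] := noH g.
  by move=> ->.
have [H0|] := pselect (forall g, H g -> bs_exp g = 0).
  by apply: Or32; rewrite (bs_closure_exp0 _ Hh) //; apply: bs_exp0_iso.
move=> /existsNP [k /not_implyP [Hk /eqP ek]].
(* Either every vector of [H] lies on the line spanned by that of [k], or some [g] in [H] is
   independent of [k]. *)
have [HC|] := pselect (forall g, H g -> bs_pos g * bs_dil k = bs_pos k * bs_dil g).
  by apply: Or33; rewrite (bs_closure_stabiliser _ Hk) //; apply: bs_stabiliser_iso.
move=> /existsNP [g /not_implyP [Hg /eqP Cg]].
by apply: Or31; apply: (bs_closure_full _ Hk Hg).
Qed.
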